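(* Let $G$ be a simply connected complex semisimple group, $H\subset G$ a maximal torus, $\theta$ a Chevalley involution of $G$ with $\theta(h)=h^{-1}$ for $h\in H$, $B\supset H$ a Borel subgroup with $B\cap\theta(B)=H$, $P\supset B$ a parabolic subgroup and $P^{opp}=\theta(P)$. Let $\lambda$ be a dominant weight whose character $\chi_\lambda$ of $H$ extends to a character of $P$ but to no larger parabolic, and let $\mathbf r$ be a weight. Let $M=G/P$ and $M^{opp}=G/P^{opp}$, with linearized line bundles $\mathcal L_{\chi_\lambda}(\mathbf r)$ and $\mathcal L_{\chi_{\lambda}\circ\theta}(-\mathbf r)$ respectively. Then the bundle isomorphism $\hat\Theta:\mathcal L_{\chi_\lambda}(\mathbf r)\to\mathcal L_{\chi_\lambda\circ\theta}(-\mathbf r)$, $\hat\Theta([g,z])=[\theta(g),z]$, induces an isomorphism of Mumford quotients $$M/\!/_{\mathbf r}H\cong M^{opp}/\!/_{-\mathbf r}H.$$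
   Context: A Chevalley involution of $G$ is a holomorphic involution whose differential, for some Cartan subalgebra, Borel and simple root vectors $x_{\alpha},x_{-\alpha}$ with $[x_\alpha,x_{-\alpha}]=h_\alpha$, is $x_{\pm\alpha}\mapsto-x_{\mp\alpha}$, $h_\alpha\mapsto-h_\alpha$ ($\alpha$ simple). For a character $\chi$ of a parabolic $P$, $\mathcal L_\chi$ is the homogeneous line bundle over $G/P$ with isotropy representation $\chi^{-1}$: the quotient of $G\times\mathbb C$ by $(g,z)\sim(gp,\chi(p)z)$, $p\in P$; similarly over $G/P^{opp}$ for the character $\chi_\lambda\circ\theta$ of $P^{opp}$. For a weight $\mathbf t$, $\mathcal L(\mathbf t)$ is the bundle with $H$-action twisted by the character $\chi_{\mathbf t}$: $h[g,z]=[hg,\chi_{\mathbf t}(h)z]$. These bundles are very ample; $M/\!/_{\mathbf r}H$ and $M^{opp}/\!/_{-\mathbf r}H$ are the GIT quotients for these linearizations, i.e. $\mathrm{Proj}$ of $\bigoplus_N\Gamma(\mathcal L^{\otimes N})^H$. *)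

(* Defs.v *)
From HB Require Import structures.
From mathcomp Require Import all_boot all_order all_algebra.
From mathcomp Require Import complex.
From mathcomp Require Import all_classical all_reals all_analysis.
From mathcomp Require Import ring.
From mathcomp Require mpoly.

Set Implicit Arguments.
Unset Strict Implicit.
Unset Printing Implicit Defensive.

Import Order.TTheory GRing.Theory Num.Theory.
Import numFieldNormedType.Exports.
Local Open Scope classical_set_scope.
Local Open Scope ring_scope.
Local Open Scope quotient_scope.


Record gradedAlg (K : comNzRingType) := GradedAlg {
  ga_ring :> comNzRingType;
  ga_const : {rmorphism K -> ga_ring};
  ga_part : nat -> set ga_ring;
  ga_constP : forall c, ga_part 0 (ga_const c);
  ga_part0 : forall d, ga_part d 0;
  ga_partB : forall d x y, ga_part d x -> ga_part d y -> ga_part d (x - y);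
  ga_partM : forall d e x y,
    ga_part d x -> ga_part e y -> ga_part (d + e) (x * y);
  ga_span : forall x, exists (m : nat) (y : nat -> ga_ring),
    (forall d, ga_part d (y d)) /\ x = \sum_(d < m) y d;
  ga_indep : forall (m : nat) (y : nat -> ga_ring),
    (forall d, ga_part d (y d)) -> \sum_(d < m) y d = 0 ->
    forall d, (d < m)%N -> y d = 0
}.

Section Proj.
Variables (K : comNzRingType) (S : gradedAlg K).

(* pp_homog: the ideal is homogeneous. pp_relevant: it does not contain S_+. *)
Record projPt := ProjPt {
  pp_set :> S -> Prop;
  pp_ideal0 : pp_set 0;
  pp_idealD : forall x y, pp_set x -> pp_set y -> pp_set (x + y);
  pp_idealM : forall a x, pp_set x -> pp_set (a * x);
  pp_proper : ~ pp_set 1;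
  pp_prime : forall x y, pp_set (x * y) -> pp_set x \/ pp_set y;
  pp_homog : forall (m : nat) (y : nat -> S), (forall d, ga_part d (y d)) ->
    pp_set (\sum_(d < m) y d) -> forall d, (d < m)%N -> pp_set (y d);
  pp_relevant : exists d x, [/\ (0 < d)%N, @ga_part K S d x & ~ pp_set x]
}.

HB.instance Definition _ := gen_eqMixin projPt.
HB.instance Definition _ := gen_choiceMixin projPt.

(* The sets D(f), f homogeneous, form a base of the Zariski topology. *)
Definition proj_open (U : set projPt) := forall p, U p ->
  exists d f, [/\ @ga_part K S d f, ~ p f & forall q : projPt, ~ q f -> U q].

Fact proj_openT : proj_open setT.
Proof. by move=> p _; have [d [f [_ Sf pf]]] := pp_relevant p; exists d, f. Qed.

Fact proj_openI : setI_closed proj_open.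
Proof.
move=> U V oU oV p [/oU [d [f [Sf pf fU]]] /oV [e [g [Sg pg gV]]]].
exists (d + e)%N, (f * g); split; first exact: ga_partM.
  by move=> /pp_prime [].
move=> q qfg; split; [apply: fU | apply: gV] => qx; apply: qfg.
- by rewrite mulrC; apply: pp_idealM.
- exact: pp_idealM.
Qed.

Fact proj_open_bigU (I : Type) (f : I -> set projPt) :
  (forall i, proj_open (f i)) -> proj_open (\bigcup_i f i).
Proof.
move=> of_ p [i _ /of_ [d [g [Sg pg gf]]]]; exists d, g; split=> // q qg.
by exists i => //; apply: gf.
Qed.

HB.instance Definition _ :=
  isOpenTopological.Build projPt proj_openT proj_openI proj_open_bigU.

(* The stalk at p: fractions a/f of homogeneous elements of the same degree
   with f outside p, modulo a/f = b/g iff t(ag - bf) = 0 for some homogeneous t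
   outside p. This is the degree-zero part of the localization of S at the
   homogeneous elements outside p. *)
Section Stalk.
Variable p : projPt.

Record hfrac := HFrac {
  hf_deg : nat;
  hf_num : S;
  hf_den : S;
  hf_numP : ga_part hf_deg hf_num;
  hf_denP : ga_part hf_deg hf_den;
  hf_den_notin : ~ p hf_den
}.

HB.instance Definition _ := gen_eqMixin hfrac.
HB.instance Definition _ := gen_choiceMixin hfrac.

Definition hf_eqv (x y : hfrac) : bool := `[< exists d t,
  [/\ @ga_part K S d t, ~ p t
    & t * (hf_num x * hf_den y - hf_num y * hf_den x) = 0] >].

Fact ga_part1 : @ga_part K S 0 1.
Proof. by rewrite -(rmorph1 (@ga_const K S)); apply: ga_constP. Qed.

Fact pp_notinM (x y : S) : ~ p x -> ~ p y -> ~ p (x * y).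
Proof. by move=> px py /pp_prime []. Qed.

Fact ga_partN d (x : S) : ga_part d x -> ga_part d (- x).
Proof. by move=> Sx; rewrite -sub0r; apply: ga_partB => //; apply: ga_part0. Qed.

Fact ga_partD d (x y : S) : ga_part d x -> ga_part d y -> ga_part d (x + y).
Proof. by move=> Sx Sy; rewrite -(opprK y); apply: ga_partB => //; apply: ga_partN. Qed.

Fact hf_eqv_refl : reflexive hf_eqv.
Proof.
move=> x; apply/asboolP; exists 0%N, 1; split; first exact: ga_part1.
  exact: pp_proper.
by rewrite subrr mulr0.
Qed.

Fact hf_eqv_sym : symmetric hf_eqv.
Proof.
move=> x y; apply/asboolP/asboolP => -[d [t [St pt E]]]; exists d, t;
  by split=> //; rewrite -opprB mulrN E oppr0.
Qed.

Fact hf_eqv_trans : transitive hf_eqv.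
Proof.
move=> y x z /asboolP[d [t [St pt E]]] /asboolP[e [u [Su pu F]]].
apply/asboolP; exists (d + e + hf_deg y)%N, (t * u * hf_den y); split.
- by apply: ga_partM; [apply: ga_partM|apply: hf_denP].
- by do 2?apply: pp_notinM => //; apply: hf_den_notin.
transitivity (u * hf_den z * (t * (hf_num x * hf_den y - hf_num y * hf_den x))
   + t * hf_den x * (u * (hf_num y * hf_den z - hf_num z * hf_den y))).
  by ring.
by rewrite E F !mulr0 addr0.
Qed.

Canonical hf_equiv := EquivRel hf_eqv hf_eqv_refl hf_eqv_sym hf_eqv_trans.

Definition stalk := {eq_quot hf_equiv}.
HB.instance Definition _ := Choice.on stalk.
HB.instance Definition _ := EqQuotient.on stalk.

Lemma stalkP (x y : hfrac) : reflect (exists d t,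
  [/\ @ga_part K S d t, ~ p t
    & t * (hf_num x * hf_den y - hf_num y * hf_den x) = 0])
  (\pi_stalk x == \pi_stalk y).
Proof. by rewrite eqmodE; apply: asboolP. Qed.

Lemma stalk_eq (x y : hfrac) : hf_num x * hf_den y = hf_num y * hf_den x ->
  \pi_stalk x = \pi_stalk y.
Proof.
move=> E; apply/eqP/stalkP; exists 0%N, 1; split; first exact: ga_part1.
  exact: pp_proper.
by rewrite E subrr mulr0.
Qed.

Definition hf_const (c : K) : hfrac :=
  HFrac (ga_constP S c) ga_part1 (@pp_proper p).

Definition hf_add (x y : hfrac) : hfrac :=
  HFrac (ga_partD (ga_partM (hf_numP x) (hf_denP y))
                  (ga_partM (hf_denP x) (hf_numP y)))
        (ga_partM (hf_denP x) (hf_denP y))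
        (pp_notinM (@hf_den_notin x) (@hf_den_notin y)).

Definition hf_opp (x : hfrac) : hfrac :=
  HFrac (ga_partN (hf_numP x)) (hf_denP x) (@hf_den_notin x).

Definition hf_mul (x y : hfrac) : hfrac :=
  HFrac (ga_partM (hf_numP x) (hf_numP y)) (ga_partM (hf_denP x) (hf_denP y))
        (pp_notinM (@hf_den_notin x) (@hf_den_notin y)).

Definition stalk_const (c : K) : stalk := \pi_stalk (hf_const c).
Definition stalk_add (x y : stalk) : stalk := \pi_stalk (hf_add (repr x) (repr y)).
Definition stalk_opp (x : stalk) : stalk := \pi_stalk (hf_opp (repr x)).
Definition stalk_mul (x y : stalk) : stalk := \pi_stalk (hf_mul (repr x) (repr y)).

Let reprE (x : hfrac) : exists d t, [/\ @ga_part K S d t, ~ p t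
  & t * (hf_num (repr (\pi_stalk x)) * hf_den x
         - hf_num x * hf_den (repr (\pi_stalk x))) = 0].
Proof. by apply/stalkP; rewrite reprK. Qed.

Lemma pi_stalk_add (x y : hfrac) :
  stalk_add (\pi_stalk x) (\pi_stalk y) = \pi_stalk (hf_add x y).
Proof.
have [d [t [St pt E]]] := reprE x; have [e [u [Su pu F]]] := reprE y.
apply/eqP/stalkP; exists (d + e)%N, (t * u); split; first exact: ga_partM.
  exact: pp_notinM.
move: E F; set x' := repr _; set y' := repr _ => E F /=.
transitivity (u * hf_den y' * hf_den y
    * (t * (hf_num x' * hf_den x - hf_num x * hf_den x'))
   + t * hf_den x * hf_den x'
    * (u * (hf_num y' * hf_den y - hf_num y * hf_den y'))); first by ring.
by rewrite E F !mulr0 addr0.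
Qed.

Lemma pi_stalk_opp (x : hfrac) : stalk_opp (\pi_stalk x) = \pi_stalk (hf_opp x).
Proof.
have [d [t [St pt E]]] := reprE x.
apply/eqP/stalkP; exists d, t; split=> //=.
by rewrite !mulNr opprK addrC -opprB mulrN E oppr0.
Qed.

Lemma pi_stalk_mul (x y : hfrac) :
  stalk_mul (\pi_stalk x) (\pi_stalk y) = \pi_stalk (hf_mul x y).
Proof.
have [d [t [St pt E]]] := reprE x; have [e [u [Su pu F]]] := reprE y.
apply/eqP/stalkP; exists (d + e)%N, (t * u); split; first exact: ga_partM.
  exact: pp_notinM.
move: E F; set x' := repr _; set y' := repr _ => E F /=.
transitivity (u * hf_num y' * hf_den y
    * (t * (hf_num x' * hf_den x - hf_num x * hf_den x'))
   + t * hf_num x * hf_den x'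
    * (u * (hf_num y' * hf_den y - hf_num y * hf_den y'))); first by ring.
by rewrite E F !mulr0 addr0.
Qed.

Let stalk_ind (P : stalk -> Prop) : (forall x, P (\pi_stalk x)) -> forall x, P x.
Proof. by move=> H x; rewrite -(reprK x). Qed.

Fact stalk_addA : associative stalk_add.
Proof.
elim/stalk_ind=> x; elim/stalk_ind=> y; elim/stalk_ind=> z.
by rewrite !pi_stalk_add; apply: stalk_eq => /=; ring.
Qed.

Fact stalk_addC : commutative stalk_add.
Proof.
elim/stalk_ind=> x; elim/stalk_ind=> y.
by rewrite !pi_stalk_add; apply: stalk_eq => /=; ring.
Qed.

Fact stalk_add0 : left_id (stalk_const 0) stalk_add.
Proof.
elim/stalk_ind=> x; rewrite pi_stalk_add; apply: stalk_eq => /=.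
by rewrite rmorph0; ring.
Qed.

Fact stalk_addN : left_inverse (stalk_const 0) stalk_opp stalk_add.
Proof.
elim/stalk_ind=> x; rewrite pi_stalk_opp pi_stalk_add; apply: stalk_eq => /=.
by rewrite rmorph0; ring.
Qed.

HB.instance Definition _ :=
  GRing.isZmodule.Build stalk stalk_addA stalk_addC stalk_add0 stalk_addN.

Fact stalk_mulA : associative stalk_mul.
Proof.
elim/stalk_ind=> x; elim/stalk_ind=> y; elim/stalk_ind=> z.
by rewrite !pi_stalk_mul; apply: stalk_eq => /=; ring.
Qed.

Fact stalk_mulC : commutative stalk_mul.
Proof.
elim/stalk_ind=> x; elim/stalk_ind=> y.
by rewrite !pi_stalk_mul; apply: stalk_eq => /=; ring.
Qed.

Fact stalk_mul1 : left_id (stalk_const 1) stalk_mul.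
Proof.
elim/stalk_ind=> x; rewrite pi_stalk_mul; apply: stalk_eq => /=.
by rewrite rmorph1; ring.
Qed.

Fact stalk_mulDl : left_distributive stalk_mul +%R.
Proof.
elim/stalk_ind=> x; elim/stalk_ind=> y; elim/stalk_ind=> z.
rewrite -![_ + _]/(stalk_add _ _) !(pi_stalk_mul, pi_stalk_add).
by apply: stalk_eq => /=; ring.
Qed.

Fact stalk_nonzero1 : stalk_const 1 != 0.
Proof.
apply/negP => /stalkP [d [t [_ pt]]] /=.
by rewrite rmorph1 rmorph0 !mulr1 subr0 mulr1 => t0; apply: pt; rewrite t0; apply: pp_ideal0.
Qed.

HB.instance Definition _ := GRing.Zmodule_isComNzRing.Build stalk
  stalk_mulA stalk_mulC stalk_mul1 stalk_mulDl stalk_nonzero1.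

Lemma stalk_addE (x y : hfrac) :
  \pi_stalk x + \pi_stalk y = \pi_stalk (hf_add x y).
Proof. exact: pi_stalk_add. Qed.

Lemma stalk_oppE (x : hfrac) : - \pi_stalk x = \pi_stalk (hf_opp x).
Proof. exact: pi_stalk_opp. Qed.

Lemma stalk_mulE (x y : hfrac) :
  \pi_stalk x * \pi_stalk y = \pi_stalk (hf_mul x y).
Proof. exact: pi_stalk_mul. Qed.

End Stalk.

(* The structure sheaf: families of germs that are locally given by a single
   homogeneous fraction a/f of degree zero. *)
Section Sheaf.
Variable U : set projPt.

Definition locally_frac (s : forall p, U p -> stalk p) := forall p, U p ->
  exists (W : set projPt) (a f : S), [/\ open W, W p
    & forall q (Uq : U q), W q ->
        exists x : hfrac q, [/\ hf_num x = a, hf_den x = f & s q Uq = \pi x]].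

Record osec := OSec {
  os_val :> forall p, U p -> stalk p;
  os_loc : locally_frac os_val
}.

Lemma osec_eq (s t : osec) : (forall p Up, s p Up = t p Up) -> s = t.
Proof.
case: s t => [s sl] [t tl] /= E.
have st : s = t by apply: functional_extensionality_dep => p; apply: functional_extensionality_dep => Up.
by move: sl tl; rewrite st => sl tl; congr OSec; apply: Prop_irrelevance.
Qed.

HB.instance Definition _ := gen_eqMixin osec.
HB.instance Definition _ := gen_choiceMixin osec.

Fact const_loc c : locally_frac (fun p _ => stalk_const p c).
Proof.
move=> p Up; exists setT, (ga_const S c), 1; split=> //; first exact: openT.
by move=> q Uq _; exists (hf_const q c).
Qed.
Definition os_const (c : K) : osec := OSec (@const_loc c).

Fact add_loc (s t : osec) : locally_frac (fun p Up => s p Up + t p Up).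
Proof.
move=> p Up; have [V [a [f [oV Vp sE]]]] := os_loc s Up.
have [W [b [g [oW Wp tE]]]] := os_loc t Up.
exists (V `&` W), (a * g + f * b), (f * g); split=> //; first exact: openI.
move=> q Uq [Vq Wq]; have [x [xa xf ->]] := sE q Uq Vq.
have [y [yb yg ->]] := tE q Uq Wq; exists (hf_add x y).
by rewrite /= xa xf yb yg stalk_addE.
Qed.
Definition os_add (s t : osec) : osec := OSec (add_loc s t).

Fact opp_loc (s : osec) : locally_frac (fun p Up => - s p Up).
Proof.
move=> p Up; have [V [a [f [oV Vp sE]]]] := os_loc s Up.
exists V, (- a), f; split=> // q Uq Vq; have [x [xa xf ->]] := sE q Uq Vq.
by exists (hf_opp x); rewrite /= xa xf stalk_oppE.
Qed.
Definition os_opp (s : osec) : osec := OSec (opp_loc s).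

Fact mul_loc (s t : osec) : locally_frac (fun p Up => s p Up * t p Up).
Proof.
move=> p Up; have [V [a [f [oV Vp sE]]]] := os_loc s Up.
have [W [b [g [oW Wp tE]]]] := os_loc t Up.
exists (V `&` W), (a * b), (f * g); split=> //; first exact: openI.
move=> q Uq [Vq Wq]; have [x [xa xf ->]] := sE q Uq Vq.
have [y [yb yg ->]] := tE q Uq Wq; exists (hf_mul x y).
by rewrite /= xa xf yb yg stalk_mulE.
Qed.
Definition os_mul (s t : osec) : osec := OSec (mul_loc s t).

Fact os_addA : associative os_add.
Proof. by move=> s t u; apply: osec_eq => p Up /=; apply: addrA. Qed.
Fact os_addC : commutative os_add.
Proof. by move=> s t; apply: osec_eq => p Up /=; apply: addrC. Qed.
Fact os_add0 : left_id (os_const 0) os_add.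
Proof. by move=> s; apply: osec_eq => p Up /=; apply: add0r. Qed.
Fact os_addN : left_inverse (os_const 0) os_opp os_add.
Proof. by move=> s; apply: osec_eq => p Up /=; apply: addNr. Qed.
Fact os_mulA : associative os_mul.
Proof. by move=> s t u; apply: osec_eq => p Up /=; apply: mulrA. Qed.
Fact os_mulC : commutative os_mul.
Proof. by move=> s t; apply: osec_eq => p Up /=; apply: mulrC. Qed.
Fact os_mul1 : left_id (os_const 1) os_mul.
Proof. by move=> s; apply: osec_eq => p Up /=; apply: mul1r. Qed.
Fact os_mulDl : left_distributive os_mul os_add.
Proof. by move=> s t u; apply: osec_eq => p Up /=; apply: mulrDl. Qed.

HB.instance Definition _ :=
  GRing.isZmodule.Build osec os_addA os_addC os_add0 os_addN.
HB.instance Definition _ :=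
  GRing.Zmodule_isComPzRing.Build osec os_mulA os_mulC os_mul1 os_mulDl.

End Sheaf.

Fact restr_loc (U V : set projPt) (VU : V `<=` U) (s : osec U) :
  locally_frac (fun p (Vp : V p) => s p (VU p Vp)).
Proof.
move=> p Vp; have [W [a [f [oW Wp sE]]]] := os_loc s (VU p Vp).
by exists W, a, f; split=> // q Vq; apply: sE.
Qed.
Definition os_restr (U V : set projPt) (VU : V `<=` U) (s : osec U) : osec V :=
  OSec (restr_loc VU s).

End Proj.

(* An isomorphism of ringed spaces over K; as both sides are locally ringed, it
   is an isomorphism of K-schemes. *)
Record projIso (K : comNzRingType) (S S' : gradedAlg K) := ProjIso {
  pi_pt : projPt S -> projPt S';
  pi_bij : bijective pi_pt;
  pi_cont : continuous pi_pt;
  pi_open : forall U, open U -> open (pi_pt @` U);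
  pi_sh : forall U : set (projPt S'), open U ->
    {rmorphism osec U -> osec (pi_pt @^-1` U)};
  pi_sh_bij : forall U (oU : open U), bijective (pi_sh oU);
  pi_sh_const : forall U (oU : open U) c, pi_sh oU (os_const U c) = os_const _ c;
  pi_sh_restr : forall U V (oU : open U) (oV : open V) (VU : V `<=` U) s,
    pi_sh oV (os_restr VU s) = os_restr (preimage_subset VU) (pi_sh oU s)
}.

(* Phi = Proj(Psi): a point p goes to Psi^-1(p), a germ a/f to Psi(a)/Psi(f). *)
Definition induced_by (K : comNzRingType) (S S' : gradedAlg K)
    (Psi : {rmorphism S' -> S}) (Phi : projIso S S') :=
  (forall p, pp_set (pi_pt Phi p) = Psi @^-1` pp_set p) /\
  (forall U (oU : open U) (s : osec U) p (Up : U (pi_pt Phi p))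
     (x : hfrac (pi_pt Phi p)), s _ Up = \pi x ->
   exists y : hfrac p, [/\ hf_num y = Psi (hf_num x),
     hf_den y = Psi (hf_den x) & pi_sh Phi oU s p Up = \pi y]).


Definition cplx (R : realType) : numFieldType := R[i].

Section MatrixGroups.
Variables (R : realType) (n : nat).
Notation C := (cplx R).
Notation V := 'M[C]_n.+1.
Implicit Types (A G H K N P B : set V).

Definition is_subgroup G := [/\ G `<=` [set x | x \is a GRing.unit], G 1,
  (forall x y, G x -> G y -> G (x * y)) & (forall x, G x -> G x^-1)].

(* Relative to GL_{n+1}(C) *)
Definition zariski_closed A := exists F : set (mpoly.mpoly (n.+1 * n.+1) C),
  A = [set x | x \is a GRing.unit
             /\ forall p, F p -> mpoly.meval (mxvec x 0) p = 0].

Definition alg_subgroup G := is_subgroup G /\ zariski_closed G.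

Definition derived_subgroup G : set V :=
  smallest is_subgroup [set x^-1 * y^-1 * x * y | x in G & y in G].

Definition solvable_group G := exists k, iter k derived_subgroup G = [set 1].

Definition normal_subgroup N G :=
  N `<=` G /\ forall g x, G g -> N x -> N (g * x * g^-1).

(* Connectedness is for the usual topology; for a complex algebraic group this is
   the same as Zariski connectedness. *)
Definition semisimple_group G := [/\ alg_subgroup G, connected G
  & forall N, alg_subgroup N -> connected N -> solvable_group N ->
      normal_subgroup N G -> N = [set 1]].

Definition simply_connected G := forall c : R -> V,
  {within `[0, 1], continuous c} -> c @` `[0, 1] `<=` G -> c 0 = c 1 ->
  exists h : R * R -> V, [/\ {within `[0, 1] `*` `[0, 1], continuous h},
    h @` (`[0, 1] `*` `[0, 1]) `<=` G,
    (forall t, 0 <= t <= 1 -> h (0, t) = c t),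
    (forall t, 0 <= t <= 1 -> h (1, t) = c 0)
  & (forall s, 0 <= s <= 1 -> h (s, 0) = c 0 /\ h (s, 1) = c 0)].

Definition is_torus H := [/\ alg_subgroup H, connected H
  & exists2 g : V, g \is a GRing.unit
    & forall x, H x -> is_diag_mx (g * x * g^-1)].

Definition maximal_torus G H := [/\ is_torus H, H `<=` G
  & forall K, is_torus K -> K `<=` G -> H `<=` K -> K = H].

Definition borel_subgroup G B :=
  [/\ alg_subgroup B, connected B, solvable_group B, B `<=` G
  & forall K, alg_subgroup K -> connected K -> solvable_group K ->
      K `<=` G -> B `<=` K -> K = B].

Definition parabolic_subgroup G P := [/\ alg_subgroup P, P `<=` G
  & exists2 B, borel_subgroup G B & B `<=` P].

(* Holomorphic functions on a locally closed submanifold A of a normed space: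
   locally restrictions of complex-differentiable functions. *)
Definition holomorphic_on (E W : normedModType C) (A : set E) (f : A -> W) :=
  forall x : A, exists (O : set E) (F : E -> W), [/\ open O, O (val x),
    (forall y, O y -> differentiable F y)
  & (forall y : A, O (val y) -> F (val y) = f y)].

Definition is_character K (chi : V -> C) := [/\ forall x, K x -> chi x != 0,
  (forall x y, K x -> K y -> chi (x * y) = chi x * chi y)
  & holomorphic_on (fun x : K => chi (val x) : C^o)].


Definition holo_curve G (c : C^o -> V) :=
  c 0 = 1 /\ \forall t \near (0 : C^o), G (c t) /\ derivable c t 1.

(* The tangent space of G at 1 *)
Definition lie_algebra G : set V :=
  [set X | exists2 c, holo_curve G c & is_derive (0 : C^o) 1 c X].

(* df_1(X) = Y, for f holomorphic on G and X in the Lie algebra of G *)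
Definition differential_at1 (W : normedModType C) G (f : V -> W) (X : V) (Y : W) :=
  exists2 c, holo_curve G c &
    is_derive (0 : C^o) 1 c X /\ is_derive (0 : C^o) 1 (f \o c) Y.

Definition bracket (X Y : V) : V := X * Y - Y * X.

Definition vbracket (U W : {vspace V}) : {vspace V} :=
  <<[seq bracket x y | x <- vbasis U, y <- vbasis W]>>%VS.

Definition lie_subalgebra (U : {vspace V}) := (vbracket U U <= U)%VS.
Definition lie_nilpotent (U : {vspace V}) :=
  exists k, iter k (vbracket U) U = 0%VS.
Definition lie_solvable (U : {vspace V}) :=
  exists k, iter k (fun W => vbracket W W) U = 0%VS.

Definition cartan_subalgebra (gg hh : {vspace V}) :=
  [/\ (hh <= gg)%VS, lie_subalgebra hh, lie_nilpotent hh
  & forall x, x \in gg -> (forall h, h \in hh -> bracket x h \in hh) -> x \in hh].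

Definition borel_subalgebra (gg bb : {vspace V}) :=
  [/\ (bb <= gg)%VS, lie_subalgebra bb, lie_solvable bb
  & forall U, (U <= gg)%VS -> lie_subalgebra U -> lie_solvable U ->
      (bb <= U)%VS -> U = bb].

(* Linear functionals on a subalgebra hh are represented by functions on V;
   their values outside hh are irrelevant. *)
Section Roots.
Variables gg hh bb : set V.
Implicit Types alpha beta : V -> C.

Definition root_space alpha : set V :=
  [set x | gg x /\ forall h, hh h -> bracket h x = alpha h *: x].

Definition is_root alpha := (exists2 h, hh h & alpha h != 0) /\
  (exists2 x, root_space alpha x & x != 0).

Definition positive_root alpha := is_root alpha /\ root_space alpha `<=` bb.

Definition simple_root alpha := positive_root alpha /\
  ~ exists beta gamma, [/\ positive_root beta, positive_root gamma
      & forall h, hh h -> alpha h = beta h + gamma h].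

(* h_alpha: the element of [g_alpha, g_{-alpha}] with alpha(h_alpha) = 2 *)
Definition is_coroot alpha (h : V) :=
  (exists x y, [/\ root_space alpha x, root_space (\- alpha) y
    & h = bracket x y]) /\ alpha h = 2.

End Roots.

Definition holo_involution G (theta : V -> V) :=
  [/\ forall x, G x -> G (theta x),
      (forall x y, G x -> G y -> theta (x * y) = theta x * theta y),
      (forall x, G x -> theta (theta x) = x)
    & holomorphic_on (fun x : G => theta (val x))].

Definition chevalley_involution G (theta : V -> V) :=
  holo_involution G theta /\
  exists gg hh bb : {vspace V}, [/\ (forall x, x \in gg <-> lie_algebra G x),
    cartan_subalgebra gg hh, borel_subalgebra gg bb, (hh <= bb)%VS
  & forall alpha : V -> C, simple_root [set` gg] [set` hh] [set` bb] alpha ->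
    exists x y h : V, [/\ root_space [set` gg] [set` hh] alpha x,
      root_space [set` gg] [set` hh] (\- alpha) y,
      bracket x y = h /\ is_coroot [set` gg] [set` hh] alpha h
    & [/\ differential_at1 G theta x (- y), differential_at1 G theta y (- x)
        & differential_at1 G theta h (- h)]]].


Definition is_weight G H (lam : V -> C) :=
  (forall (a : C) x y, lie_algebra H x -> lie_algebra H y ->
     lam (a *: x + y) = a * lam x + lam y) /\
  (forall alpha h, is_root (lie_algebra G) (lie_algebra H) alpha ->
     is_coroot (lie_algebra G) (lie_algebra H) alpha h ->
     exists m : int, lam h = m%:~R).

Definition dominant_weight G H B (lam : V -> C) := is_weight G H lam /\
  forall alpha h,
    positive_root (lie_algebra G) (lie_algebra H) (lie_algebra B) alpha ->
    is_coroot (lie_algebra G) (lie_algebra H) alpha h -> 0 <= lam h.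

(* chi is the character chi_lam of H, i.e. the one with differential lam *)
Definition weight_character H (lam chi : V -> C) := is_character H chi /\
  forall X, lie_algebra H X -> differential_at1 H (chi : V -> C^o) X (lam X).

Definition extends_to H P (chi0 chi : V -> C) :=
  is_character P chi /\ forall h, H h -> chi h = chi0 h.

End MatrixGroups.


Section LineBundles.
Variables (R : realType) (n : nat).
Notation C := (cplx R).
Notation V := 'M[C]_n.+1.

(* The data defining L_chi over G/P with the action of H twisted by tw *)
Record linBundle := LinBundle {
  lb_grp : set V;
  lb_par : set V;
  lb_chi : V -> C;
  lb_tor : set V;
  lb_tw : V -> C;
  lb_grpP : is_subgroup lb_grp;
  lb_parP : is_subgroup lb_par;
  lb_par_sub : lb_par `<=` lb_grp;
  lb_chiP : is_character lb_par lb_chi;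
  lb_torP : is_subgroup lb_tor;
  lb_tor_sub : lb_tor `<=` lb_grp;
  lb_twP : is_character lb_tor lb_tw
}.

Section OneBundle.
Variable L : linBundle.

Definition lb_pts : Type := lb_grp L.
HB.instance Definition _ := SubChoice.on lb_pts.
Fact lb_pts1 : 1 \in lb_grp L.
Proof. by have [_ G1 _ _] := lb_grpP L; apply: mem_set. Qed.
HB.instance Definition _ :=
  isPointed.Build lb_pts (exist (fun g => g \in lb_grp L) 1 lb_pts1).

Definition coset_pt (g : V) : set V := [set g * p | p in lb_par L].
Definition base_space : set (set V) := [set coset_pt g | g in lb_grp L].

(* The class [g, z] in the N-th tensor power of L_chi. This power is the bundle
   of chi^N, with [g, z_1] (x) ... (x) [g, z_N] = [g, z_1 ... z_N]. *)
Definition cls (N : nat) (g : V) (z : C) : set (V * C^o) :=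
  [set (g * p, lb_chi L p ^+ N * z) | p in lb_par L].
Definition total_space (N : nat) : set (set (V * C^o)) :=
  [set c | exists2 g, lb_grp L g & exists z, c = cls N g z].

(* [g, z] |-> gP *)
Definition proj_base (c : set (V * C^o)) : set V := [set q.1 | q in c].

(* h[g, z] = [hg, tw(h)^N z] and h(gP) = hgP *)
Definition act_total (N : nat) (h : V) (c : set (V * C^o)) : set (V * C^o) :=
  [set (h * q.1, lb_tw L h ^+ N * q.2) | q in c].
Definition act_base (h : V) (x : set V) : set V := [set h * g | g in x].

(* A section s of the N-th power has a coordinate f : G -> C, s(gP) = [g, f(g)].
   Since G -> G/P and G x C -> L_chi are holomorphic principal P-bundles, s is
   holomorphic iff f is. *)
Definition is_section (N : nat) (s : set V -> set (V * C^o)) :=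
  forall x, base_space x -> total_space N (s x) /\ proj_base (s x) = x.

Definition section_coord (N : nat) (s : set V -> set (V * C^o))
    (f : lb_pts -> C) :=
  forall g : lb_pts, s (coset_pt (val g)) = cls N (val g) (f g).

Definition invariant_section (N : nat) (s : set V -> set (V * C^o)) :=
  forall h x, lb_tor L h -> base_space x -> s (act_base h x) = act_total N h (s x).

Definition inv_coord (N : nat) (f : lb_pts -> C) :=
  holomorphic_on (f : lb_pts -> C^o) /\
  exists s, [/\ is_section N s, invariant_section N s & section_coord N s f].

Lemma cls_eq N (g g' : V) (z z' : C) : lb_grp L g -> lb_grp L g' ->
  (cls N g z = cls N g' z' <->
   exists2 p, lb_par L p & g' = g * p /\ z' = lb_chi L p ^+ N * z).
Proof.
have [chi0 chiM _] := lb_chiP L; have [Pu P1 PM PV] := lb_parP L.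
have chi1 : lb_chi L 1 = 1.
  by apply: (mulfI (chi0 _ P1)); rewrite -chiM// !mulr1.
move=> Gg Gg'; split.
  move=> E; have : cls N g' z' (g', z').
    by exists 1 => //; rewrite chi1 expr1n mul1r mulr1.
  by rewrite -E => -[p Pp [<- <-]]; exists p.
move=> [p Pp [-> ->]]; apply/seteqP; split=> [_ [q Pq <-]|_ [q Pq <-]].
- have Ppq : lb_par L (p^-1 * q) by apply: PM => //; apply: PV.
  exists (p^-1 * q) => //.
  rewrite -mulrA mulVKr; last exact: Pu.
  rewrite mulrA -exprMn [lb_chi L _ * _]mulrC -chiM// mulVKr//; exact: Pu.
- exists (p * q); first exact: PM.
  by rewrite !mulrA chiM// exprMn [_ ^+ N * lb_chi L q ^+ N]mulrC.
Qed.

Lemma inv_coordP N (f : lb_pts -> C) : inv_coord N f <->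
  [/\ holomorphic_on (f : lb_pts -> C^o),
      (forall g g' : lb_pts, forall p, lb_par L p -> val g' = val g * p ->
         f g' = lb_chi L p ^+ N * f g)
    & (forall g g' : lb_pts, forall h, lb_tor L h -> val g' = h * val g ->
         f g' = lb_tw L h ^+ N * f g)].
Proof.
have [Gu G1 GM GV] := lb_grpP L; have [Pu P1 PM PV] := lb_parP L.
have inG (g : lb_pts) : lb_grp L (val g) by have := valP g; rewrite inE.
have inU (g : lb_pts) : val g \is a GRing.unit by apply: Gu.
have mk g : lb_grp L g -> exists g' : lb_pts, val g' = g.
  by move=> Gg; exists (exist (fun x => x \in lb_grp L) g (mem_set Gg)).
have act_cls h g z : act_total N h (cls N g z) = cls N (h * g) (lb_tw L h ^+ N * z).
  apply/seteqP; split=> [_ [_ [p Pp <-] <-]|_ [p Pp <-]].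
    by exists p => //=; rewrite -mulrA; congr (_, _); apply: mulrCA.
  exists (g * p, lb_chi L p ^+ N * z); first by exists p.
  by rewrite /= -mulrA; congr (_, _); apply: mulrCA.
have act_coset h g : act_base h (coset_pt g) = coset_pt (h * g).
  apply/seteqP; split=> [_ [_ [p Pp <-] <-]|_ [p Pp <-]].
    by exists p => //; rewrite mulrA.
  by exists (g * p); [exists p|rewrite mulrA].
have coset_eq g g' : lb_grp L g' -> coset_pt g = coset_pt g' ->
    exists2 p, lb_par L p & g' = g * p.
  move=> Gg' E; have : coset_pt g' g' by exists 1 => //; rewrite mulr1.
  by rewrite -E => -[p Pp <-]; exists p.
have coset_mul g p : lb_par L p -> coset_pt (g * p) = coset_pt g.
  move=> Pp; apply/seteqP; split=> [_ [q Pq <-]|_ [q Pq <-]].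
    by exists (p * q); [exact: PM|rewrite mulrA].
  exists (p^-1 * q); first by apply: PM => //; apply: PV.
  by rewrite -mulrA mulVKr//; apply: Pu.
split=> [[hf [s [_ inv sf]]]|[hf eqP eqH]].
- split=> // [g g' p Pp g'E|g g' h Hh g'E].
    have := sf g'; rewrite g'E coset_mul// sf -g'E => /cls_eq[]//.
    move=> q Pq [g'E' ->]; have -> // : q = p.
    by apply: (mulrI (inU g)); rewrite -g'E' -g'E.
  have Bg : base_space (coset_pt (val g)) by exists (val g).
  have := inv h _ Hh Bg; rewrite act_coset -g'E !sf act_cls -g'E.
  move=> /cls_eq[]// q Pq [g'E' E].
  have q1 : q = 1 by apply: (mulrI (inU g')); rewrite -g'E' mulr1.
  have [chi0 chiM _] := lb_chiP L.
  have chi1 : lb_chi L 1 = 1.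
    by apply: (mulfI (chi0 _ P1)); rewrite -chiM// !mulr1.
  by rewrite E q1 chi1 expr1n mul1r.
- split=> //.
  pose s x : set (V * C^o) := \bigcup_(g in [set g : lb_pts | x = coset_pt (val g)])
    cls N (val g) (f g).
  have sf : section_coord N s f.
    move=> g; apply/seteqP; split=> c; last by exists g.
    move=> [g' /= gg'].
    have [p Pp g'E] := coset_eq _ _ (inG g') gg'.
    suff -> : cls N (val g) (f g) = cls N (val g') (f g') by [].
    by apply/cls_eq => //; exists p => //; split=> //; apply: eqP.
  exists s; split=> //.
  + move=> _ [g0 /mk[g <-] <-]; rewrite sf; split.
      by exists (val g) => //; exists (f g).
    apply/seteqP; split=> [_ [_ [p Pp <-] <-]|_ [p Pp <-]]; first by exists p.
    by exists (val g * p, lb_chi L p ^+ N * f g) => //; exists p.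
  + move=> h _ Hh [g0 /mk[g <-] <-].
    have [g' g'E] : exists g' : lb_pts, val g' = h * val g.
      by apply: mk; apply: GM => //; apply: lb_tor_sub Hh.
    rewrite act_coset sf act_cls -g'E sf; congr cls; exact: (eqH g).
Qed.

Let Fn : Type := lb_pts -> C.

Fact inv_coord0 N : inv_coord N (0 : Fn).
Proof.
apply/inv_coordP; split=> [g|g g' p _ _|g g' h _ _]; rewrite ?mulr0//.
by exists setT, (cst 0); split=> //; exact: openT.
Qed.

Fact inv_coordB N (f f' : Fn) :
  inv_coord N f -> inv_coord N f' -> inv_coord N (f - f' : Fn).
Proof.
move=> /inv_coordP[hf fP fH] /inv_coordP[hf' f'P f'H].
apply/inv_coordP; split=> [g|g g' p Pp g'E|g g' h Hh g'E].
- have [U [F [oU Ug dF EF]]] := hf g; have [U' [F' [oU' U'g dF' EF']]] := hf' g.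
  exists (U `&` U'), (fun y => F y - F' y : C^o); split.
  + exact: openI.
  + by split.
  + by move=> y [Uy U'y]; apply: differentiableB; [apply: dF|apply: dF'].
  + by move=> y [Uy U'y]; rewrite (EF _ Uy) (EF' _ U'y).
- by rewrite -![(f - f') _]/(f _ - f' _) (fP _ _ _ Pp g'E) (f'P _ _ _ Pp g'E) mulrBr.
- by rewrite -![(f - f') _]/(f _ - f' _) (fH _ _ _ Hh g'E) (f'H _ _ _ Hh g'E) mulrBr.
Qed.

Fact inv_coordC (c : C) : inv_coord 0 (cst c : Fn).
Proof.
apply/inv_coordP; split=> [g|g g' p _ _|g g' h _ _]; rewrite ?expr0 ?mul1r//.
by exists setT, (cst c); split=> //; exact: openT.
Qed.

Fact inv_coordM N N' (f f' : Fn) :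
  inv_coord N f -> inv_coord N' f' -> inv_coord (N + N') (f * f' : Fn).
Proof.
move=> /inv_coordP[hf fP fH] /inv_coordP[hf' f'P f'H].
apply/inv_coordP; split=> [g|g g' p Pp g'E|g g' h Hh g'E].
- have [U [F [oU Ug dF EF]]] := hf g; have [U' [F' [oU' U'g dF' EF']]] := hf' g.
  exists (U `&` U'), (fun y => (F y : C) * F' y : C^o); split.
  + exact: openI.
  + by split.
  + move=> y [Uy U'y]; apply: (@differentiableM C V F F'); [exact: dF|exact: dF'].
  + by move=> y [Uy U'y]; rewrite (EF _ Uy) (EF' _ U'y).
- rewrite -![(f * f') _]/(f _ * f' _) (fP _ _ _ Pp g'E) (f'P _ _ _ Pp g'E).
  by rewrite exprD mulrACA.
- rewrite -![(f * f') _]/(f _ * f' _) (fH _ _ _ Hh g'E) (f'H _ _ _ Hh g'E).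
  by rewrite exprD mulrACA.
Qed.

(* The direct sum over N of the spaces of H-invariant holomorphic sections of the
   N-th power, as polynomials whose N-th coefficient is the coordinate of such a
   section: [g, a] + [g, b] = [g, a + b] and [g, a] (x) [g, b] = [g, ab]. *)
Definition inv_poly : {pred {poly Fn}} :=
  [pred p : {poly Fn} | `[< forall N, inv_coord N p`_N >]].

Fact inv_poly_subring : subring_closed inv_poly.
Proof.
split=> [|p q /asboolP Ip /asboolP Iq|p q /asboolP Ip /asboolP Iq];
  apply/asboolP => N.
- rewrite coef1; case: eqP => [->|_]; last exact: inv_coord0.
  exact: (inv_coordC 1).
- by rewrite coefB; apply: inv_coordB.
- rewrite coefM; elim/big_ind: _ => [|f f' If If'|i _]; first exact: inv_coord0.
    rewrite -(opprK f') -(sub0r f'); apply: inv_coordB => //.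
    by apply: inv_coordB => //; apply: inv_coord0.
  by rewrite -[X in inv_coord X](subnKC (leq_ord i)); apply: inv_coordM.
Qed.
HB.instance Definition _ :=
  GRing.isSubringClosed.Build {poly Fn} inv_poly inv_poly_subring.

Record inv_ring := InvRing {inv_val :> {poly Fn}; _ : inv_val \in inv_poly}.
HB.instance Definition _ := [isSub for inv_val].
HB.instance Definition _ := [Choice of inv_ring by <:].
HB.instance Definition _ := [SubChoice_isSubComNzRing of inv_ring by <:].

Fact inv_const_subproof (c : C) : (cst c : Fn)%:P \in inv_poly.
Proof.
apply/asboolP => N; rewrite coefC; case: eqP => [->|_]; first exact: inv_coordC.
exact: inv_coord0.
Qed.
Definition inv_const (c : C) : inv_ring := InvRing (inv_const_subproof c).

Fact inv_const_additive : zmod_morphism inv_const.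
Proof. by move=> a b; apply: val_inj; rewrite /= -polyCB. Qed.
Fact inv_const_multiplicative : monoid_morphism inv_const.
Proof. by split=> [|a b]; apply: val_inj => //=; rewrite -polyCM. Qed.
HB.instance Definition _ :=
  GRing.isZmodMorphism.Build C inv_ring inv_const inv_const_additive.
HB.instance Definition _ :=
  GRing.isMonoidMorphism.Build C inv_ring inv_const inv_const_multiplicative.

Definition inv_part (N : nat) : set inv_ring :=
  [set p | forall i, i <> N -> (inv_val p)`_i = 0].

Fact inv_part_const c : inv_part 0 (inv_const c).
Proof. by move=> i /eqP i0; rewrite coefC (negbTE i0). Qed.

Fact inv_part_0 N : inv_part N 0.
Proof. by move=> i _; rewrite coef0. Qed.

Fact inv_part_B N x y : inv_part N x -> inv_part N y -> inv_part N (x - y).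
Proof. by move=> Ix Iy i iN; rewrite coefB Ix// Iy// subr0. Qed.

Fact inv_part_M N N' x y :
  inv_part N x -> inv_part N' y -> inv_part (N + N') (x * y).
Proof.
move=> Ix Iy i iN; rewrite coefM big1// => j _.
have [jN|/eqP jN] := eqVneq (j : nat) N; last by rewrite Ix// mul0r.
rewrite (Iy (i - j)%N) ?mulr0// => E; apply: iN.
by rewrite -jN -E subnKC// -ltnS.
Qed.

Fact inv_part_subproof (x : inv_ring) (N : nat) :
  ((inv_val x)`_N *: 'X^N : {poly Fn}) \in inv_poly.
Proof.
apply/asboolP => i; rewrite coefZ coefXn; case: eqP => [->|_].
  by rewrite mulr1; have /asboolP := valP x; apply.
by rewrite mulr0; apply: inv_coord0.
Qed.

Fact inv_val_sum (m : nat) (y : nat -> inv_ring) :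
  inv_val (\sum_(d < m) y d) = \sum_(d < m) inv_val (y d).
Proof. exact: (raddf_sum (val : inv_ring -> {poly Fn})). Qed.

Fact inv_part_span x : exists (m : nat) (y : nat -> inv_ring),
  (forall N, inv_part N (y N)) /\ x = \sum_(N < m) y N.
Proof.
exists (size (inv_val x)), (fun N => InvRing (inv_part_subproof x N)); split.
  by move=> N i /eqP iN; rewrite /= coefZ coefXn (negbTE iN) mulr0.
apply: val_inj; rewrite -[LHS]coefK poly_def; apply: esym.
exact: (inv_val_sum _ (fun N => InvRing (inv_part_subproof x N))).
Qed.

Fact inv_part_indep (m : nat) (y : nat -> inv_ring) :
  (forall N, inv_part N (y N)) -> \sum_(N < m) y N = 0 ->
  forall N, (N < m)%N -> y N = 0.
Proof.
move=> Iy /(congr1 inv_val); rewrite (inv_val_sum _ y) => E N Nm.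
apply: val_inj; apply/polyP => i; rewrite /= coef0.
have [->|/eqP iN] := eqVneq i N; last exact: Iy.
move/polyP/(_ N): E; rewrite /= coef0 coef_sum (bigD1 (Ordinal Nm))//= big1 ?addr0//.
by move=> j jN; apply: Iy => NE; case/eqP: jN; apply: val_inj.
Qed.

Definition inv_alg : gradedAlg C :=
  @GradedAlg C inv_ring inv_const inv_part inv_part_const inv_part_0
    inv_part_B inv_part_M inv_part_span inv_part_indep.

End OneBundle.
End LineBundles.


Section Bundles.
Variables (R : realType) (n : nat).
Notation C := (cplx R).
Notation V := 'M[C]_n.+1.
Variables (G H P : set V) (theta : V -> V) (chi tw : V -> C).

Lemma holomorphic_on_comp (E W W' : normedModType C) (A : set E) (B : set W)
    (f : E -> W) (g : W -> W') :
  (forall x, A x -> B (f x)) -> holomorphic_on (fun x : A => f (val x)) ->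
  holomorphic_on (fun y : B => g (val y)) ->
  holomorphic_on (fun x : A => g (f (val x))).
Proof.
move=> AB hf hg x; have [U [F [oU Ux dF FE]]] := hf x.
have fxB : f (val x) \in B by apply/mem_set/AB/set_mem/valP.
have [U' [F' [oU' U'x dF' FE']]] := hg (exist (fun y => y \in B) _ fxB).
exists (U `&` F @^-1` U'), (F' \o F); split.
- rewrite openE => y [Uy U'y]; apply: filterI; first exact: open_nbhs_nbhs.
  apply: (differentiable_continuous (dF _ Uy)); exact: open_nbhs_nbhs.
- by split=> //=; rewrite FE.
- by move=> y [Uy U'y]; apply: differentiable_comp; [exact: dF|exact: dF'].
- move=> y [Uy U'y]; rewrite /= FE//.
  have fyB : f (val y) \in B by apply/mem_set/AB/set_mem/valP.
  by apply: (FE' (exist (fun y => y \in B) _ fyB)); rewrite /= -FE.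
Qed.

Lemma holomorphic_onS (E W : normedModType C) (A B : set E) (f : E -> W) :
  A `<=` B -> holomorphic_on (fun x : B => f (val x)) ->
  holomorphic_on (fun x : A => f (val x)).
Proof.
move=> AB hf x; have xB : val x \in B by apply/mem_set/AB/set_mem/valP.
have [U [F [oU Ux dF FE]]] := hf (exist (fun y => y \in B) _ xB).
exists U, F; split=> // y Uy.
have yB : val y \in B by apply/mem_set/AB/set_mem/valP.
exact: (FE (exist (fun y => y \in B) _ yB)).
Qed.

Hypothesis hG : semisimple_group G.
Hypothesis hH : maximal_torus G H.
Hypothesis hP : parabolic_subgroup G P.

Fact semisimple_subgroup : is_subgroup G.
Proof. by have [[]] := hG. Qed.
Fact torus_subgroup : is_subgroup H.
Proof. by have [[[]]] := hH. Qed.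
Fact torus_sub : H `<=` G.
Proof. by have [] := hH. Qed.
Fact parabolic_is_subgroup : is_subgroup P.
Proof. by have [[]] := hP. Qed.
Fact parabolic_sub : P `<=` G.
Proof. by have [] := hP. Qed.

Hypothesis hchi : is_character P chi.
Hypothesis htw : is_character H tw.

(* L_chi over G/P, with H acting by h[g, z] = [hg, tw(h) z] *)
Definition hom_bundle : linBundle R n :=
  LinBundle semisimple_subgroup parabolic_is_subgroup parabolic_sub hchi
    torus_subgroup torus_sub htw.

Hypothesis htheta : chevalley_involution G theta.

Fact opp_sub : theta @` P `<=` G.
Proof.
have [[thG _ _ _] _] := htheta.
by move=> _ [p /parabolic_sub Gp <-]; apply: thG.
Qed.

Fact opp_subgroup : is_subgroup (theta @` P).
Proof.
have [[thG thM thK _] _] := htheta; have [Gu G1 GM GV] := semisimple_subgroup.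
have [Pu P1 PM PV] := parabolic_is_subgroup; have PG := parabolic_sub.
have th1 : theta 1 = 1.
  apply: (@mulrI _ (theta 1)); first by apply: Gu; apply: thG.
  by rewrite -thM// !mulr1.
split.
- by move=> _ [p Pp <-]; apply: Gu; apply: thG; apply: PG.
- by exists 1.
- move=> _ _ [p Pp <-] [q Pq <-]; exists (p * q); first exact: PM.
  by rewrite thM//; apply: PG.
- move=> _ [p Pp <-]; exists p^-1; first exact: PV.
  have up : theta p \is a GRing.unit by apply: Gu; apply: thG; apply: PG.
  apply: (mulrI up); rewrite divrr// -thM; last exact/PG/PV.
    by rewrite divrr// ; apply: Pu.
  exact: PG.
Qed.

Fact opp_character : is_character (theta @` P) (chi \o theta).
Proof.
have [[thG thM thK thh] _] := htheta; have PG := parabolic_sub.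
have [chi0 chiM chih] := hchi.
have thP x : (theta @` P) x -> P (theta x).
  by move=> [p Pp <-]; rewrite thK//; apply: PG.
split.
- by move=> x /thP Px; apply: chi0.
- move=> x y Px Py; rewrite /= thM; [|exact: opp_sub|exact: opp_sub].
  by apply: chiM; apply: thP.
- exact: (holomorphic_on_comp thP (holomorphic_onS opp_sub thh) chih).
Qed.

Fact inv_character : is_character H (fun h => (tw h)^-1).
Proof.
have [tw0 twM twh] := htw; split.
- by move=> x Hx; rewrite invr_eq0; apply: tw0.
- by move=> x y Hx Hy; rewrite twM// invfM.
move=> x; have [U [F [oU Ux dF FE]]] := twh x.
have Hx : H (val x) by apply/set_mem/valP.
exists (U `&` F @^-1` [set z | (z : C) != 0]), (fun y => (F y : C)^-1 : C^o); split.
- rewrite openE => y [Uy Fy]; apply: filterI; first exact: open_nbhs_nbhs.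
  apply: (differentiable_continuous (dF _ Uy)); apply: open_nbhs_nbhs; split=> //.
  have -> : [set z : C^o | (z : C) != 0] = ~` [set (0 : C^o)].
    by apply/seteqP; split=> z /= /eqP.
  apply/closed_openC/accessible_closed_set1/hausdorff_accessible.
  exact: norm_hausdorff.
- by split=> //=; rewrite FE//; apply: tw0.
- by move=> y [Uy Fy]; apply: (@differentiableV C V F) => //; apply: dF.
- by move=> y [Uy Fy]; rewrite FE.
Qed.

(* L_{chi o theta} over G/P^opp, where P^opp = theta(P), with H acting by
   h[g, z] = [hg, tw(h)^-1 z]: if tw is the character of the weight r, then tw^-1
   is the one of -r. *)
Definition opp_bundle : linBundle R n :=
  LinBundle semisimple_subgroup opp_subgroup opp_sub opp_character
    torus_subgroup torus_sub inv_character.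

End Bundles.


(* Let q : A -> X be surjective, A a submanifold of a normed space, and X carry
   the quotient topology and the functions on open sets of X that are holomorphic
   on A. For G -> G/P and G x C -> L_chi this is the complex structure. *)
Section QuotientHolomorphic.
Variables (R : realType).
Notation C := (cplx R).

Definition quot_open (E : normedModType C) (A : set E) X (q : E -> X)
    (W : set X) := exists2 U : set E, open U & forall e, A e -> (W (q e) <-> U e).

Definition quot_holo (E : normedModType C) (A : set E) X (q : E -> X)
    (W : set X) (phi : X -> C^o) := forall e, A e -> W (q e) ->
  exists (U : set E) (F : E -> C^o), [/\ open U, U e,
    (forall y, U y -> differentiable F y)
  & (forall y, U y -> A y -> W (q y) /\ F y = phi (q y))].

(* A map is holomorphic iff it is continuous and pulls holomorphic functions on
   open sets back to holomorphic functions. *)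
Definition quot_holo_map (E E' : normedModType C) (A : set E) (A' : set E')
    X X' (q : E -> X) (q' : E' -> X') (T : X -> X') :=
  forall W phi, quot_open A' q' W -> quot_holo A' q' W phi ->
    quot_open A q (T @^-1` W) /\ quot_holo A q (T @^-1` W) (phi \o T).

End QuotientHolomorphic.

Section BundleMaps.
Variables (R : realType) (n : nat).
Notation C := (cplx R).
Notation V := 'M[C]_n.+1.
Implicit Types L : linBundle R n.

Definition total_pt L (e : V * C^o) : set (V * C^o) := cls L 1 e.1 e.2.

Record bundle_map L L' (T : set (V * C^o) -> set (V * C^o))
    (t : set V -> set V) : Prop := BundleMap {
  bm_total : forall c, total_space L 1 c -> total_space L' 1 (T c);
  bm_base : forall x, base_space L x -> base_space L' (t x);
  bm_cover : forall c, total_space L 1 c -> proj_base (T c) = t (proj_base c);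
  bm_linear : forall g, lb_grp L g -> exists2 g', lb_grp L' g' &
    exists a, forall z, T (cls L 1 g z) = cls L' 1 g' (a * z);
  bm_holo : quot_holo_map (lb_grp L `*` setT) (lb_grp L' `*` setT)
    (total_pt L) (total_pt L') T;
  bm_holo_base : quot_holo_map (lb_grp L) (lb_grp L')
    (coset_pt L) (coset_pt L') t
}.

Definition bundle_iso L L' T t := bundle_map L L' T t /\
  exists T' t', [/\ bundle_map L' L T' t',
    (forall c, total_space L 1 c -> T' (T c) = c),
    (forall c, total_space L' 1 c -> T (T' c) = c),
    (forall x, base_space L x -> t' (t x) = x)
  & (forall x, base_space L' x -> t (t' x) = x)].

(* Theta(gP) = theta(g)P^opp and Theta^([g, z]) = [theta(g), z], as image maps on
   cosets and on equivalence classes. The second formula also describes the N-th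
   tensor power of Theta^. *)
Definition Theta (theta : V -> V) (x : set V) : set V := theta @` x.
Definition hatTheta (theta : V -> V) (c : set (V * C^o)) : set (V * C^o) :=
  [set (theta q.1, q.2) | q in c].

(* Psi sends the section s' of the N-th power over G/P' to its pullback
   x |-> T^-1(s'(t(x))), a section of the N-th power over G/P. *)
Definition section_pullback L L' (T : set (V * C^o) -> set (V * C^o))
    (t : set V -> set V) (Psi : inv_ring L' -> inv_ring L) :=
  forall N (a : inv_ring L') s' s,
    section_coord N s' (inv_val a)`_N -> section_coord N s (inv_val (Psi a))`_N ->
    forall x, base_space L x -> T (s x) = s' (t x).

(* The GIT quotient of G/P by H is Proj (inv_alg L). *)
Definition induces_quotient_iso L L' (T : set (V * C^o) -> set (V * C^o))
    (t : set V -> set V) :=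
  exists (Psi : {rmorphism inv_alg L' -> inv_alg L}),
  exists (Phi : projIso (inv_alg L) (inv_alg L')),
  [/\ bijective Psi, (forall N, Psi @` inv_part N = inv_part N),
      (forall c, Psi (inv_const L' c) = inv_const L c),
      section_pullback T t Psi & induced_by Psi Phi].

End BundleMaps.

(* Main.v *)
Require Import Defs.
From HB Require Import structures.
From mathcomp Require Import all_boot all_order all_algebra.
From mathcomp Require Import all_classical all_reals all_analysis.

Set Implicit Arguments.
Unset Strict Implicit.
Unset Printing Implicit Defensive.

Import Order.TTheory GRing.Theory Num.Theory.
Import numFieldNormedType.Exports.
Local Open Scope classical_set_scope.
Local Open Scope ring_scope.
Local Open Scope quotient_scope.

(* [theta] is multiplicative, maps P to P^opp and inverts H, so f |-> f \o theta
   turns coordinates G -> C of H-invariant sections over G/P^opp for the twist -r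
   into coordinates of H-invariant sections over G/P for the twist r. As [theta] is
   a holomorphic involution, this is an isomorphism of graded algebras, and Proj
   of it is the isomorphism of quotients. *)

(** * Functoriality of Proj for isomorphisms of graded algebras *)

Record gradedIso (K : comNzRingType) (S' S : gradedAlg K) := GradedIso {
  gi_fun : {rmorphism S' -> S};
  gi_inv : {rmorphism S -> S'};
  gi_funK : cancel gi_fun gi_inv;
  gi_invK : cancel gi_inv gi_fun;
  gi_part : forall d x, ga_part d x -> ga_part d (gi_fun x);
  gi_inv_part : forall d x, ga_part d x -> ga_part d (gi_inv x);
  gi_const : forall c, gi_fun (ga_const S' c) = ga_const S c;
  gi_inv_const : forall c, gi_inv (ga_const S c) = ga_const S' c
}.

(** Both directions are stored with their compatibilities, so inversion only swaps fields, and every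
    construction made for [A] serves for its inverse too. *)
Definition gradedIso_sym (K : comNzRingType) (S' S : gradedAlg K)
    (A : gradedIso S' S) : gradedIso S S' :=
  GradedIso (gi_invK A) (gi_funK A) (gi_inv_part A) (gi_part A)
    (gi_inv_const A) (gi_const A).

Lemma projPt_eq (K : comNzRingType) (S : gradedAlg K) (p q : projPt S) :
  (forall x, p x <-> q x) -> p = q.
Proof.
case: p q => [p p0 pD pM p1 pP ph pr] [q q0 qD qM q1 qP qh qr] /= E.
have pq : p = q by apply/funext => x; apply/propext.
by subst q; congr ProjPt; apply: Prop_irrelevance.
Qed.

Section ProjMap.
Variables (K : comNzRingType) (S' S : gradedAlg K) (A : gradedIso S' S).
Let Psi := gi_fun A.

Section Point.
Variable p : projPt S.
Let ps (x : S') : Prop := p (Psi x).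

Fact proj_map_0 : ps 0.
Proof. by rewrite /ps rmorph0; apply: pp_ideal0. Qed.

Fact proj_map_D x y : ps x -> ps y -> ps (x + y).
Proof. by rewrite /ps rmorphD; apply: pp_idealD. Qed.

Fact proj_map_M a x : ps x -> ps (a * x).
Proof. by rewrite /ps rmorphM; apply: pp_idealM. Qed.

Fact proj_map_1 : ~ ps 1.
Proof. by rewrite /ps rmorph1; apply: pp_proper. Qed.

Fact proj_map_prime x y : ps (x * y) -> ps x \/ ps y.
Proof. by rewrite /ps rmorphM; apply: pp_prime. Qed.

Fact proj_map_homog (m : nat) (y : nat -> S') : (forall d, ga_part d (y d)) ->
  ps (\sum_(d < m) y d) -> forall d, (d < m)%N -> ps (y d).
Proof.
move=> Sy; rewrite /ps rmorph_sum => /(pp_homog (y := fun d => Psi (y d))); apply.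
by move=> d; apply: gi_part.
Qed.

(** Under a general graded morphism the preimage of a relevant prime may contain the whole
    irrelevant ideal. Here the inverse carries a witness outside [p] back to [S']. *)
Fact proj_map_relevant :
  exists d x, [/\ (0 < d)%N, ga_part (g := S') d x & ~ ps x].
Proof.
have [d [x [d0 Sx px]]] := pp_relevant p; exists d, (gi_inv A x); split=> //.
  exact: gi_inv_part.
by rewrite /ps gi_invK.
Qed.

Definition proj_map : projPt S' :=
  ProjPt proj_map_0 proj_map_D proj_map_M proj_map_1 proj_map_prime
    proj_map_homog proj_map_relevant.

(** Membership in [proj_map p] unfolds to membership of the image under [Psi] in [p], so the same
    proof term shows that the new denominator avoids [p]. *)
Definition hf_map (x : hfrac proj_map) : hfrac p :=
  @HFrac K S p _ _ _ (gi_part A (hf_numP x)) (gi_part A (hf_denP x))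
    (@hf_den_notin _ _ _ x).

Definition germ_map (x : stalk proj_map) : stalk p :=
  \pi_(stalk p) (hf_map (repr x)).

(** Independence of the representative: [Psi] sends the multiplier [t] that identifies two fractions
    to one that identifies their images. *)
Lemma germ_map_pi (x : hfrac proj_map) :
  germ_map (\pi x) = \pi_(stalk p) (hf_map x).
Proof.
have /eqP/stalkP[d [t [St pt E]]] : \pi_(stalk proj_map) (repr (\pi_(stalk proj_map) x))
    = \pi_(stalk proj_map) x by rewrite reprK.
apply/eqP/stalkP; exists d, (Psi t); split=> //; first exact: gi_part.
by rewrite /= -!rmorphM -rmorphB -rmorphM E rmorph0.
Qed.

Lemma germ_mapD x y : germ_map (x + y) = germ_map x + germ_map y.
Proof.
rewrite -(reprK x) -(reprK y) stalk_addE !germ_map_pi stalk_addE.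
by apply: stalk_eq; rewrite /= rmorphD !rmorphM.
Qed.

Lemma germ_mapM x y : germ_map (x * y) = germ_map x * germ_map y.
Proof.
rewrite -(reprK x) -(reprK y) stalk_mulE !germ_map_pi stalk_mulE.
by apply: stalk_eq; rewrite /= !rmorphM.
Qed.

Lemma germ_map_const c : germ_map (stalk_const _ c) = stalk_const p c.
Proof.
by rewrite germ_map_pi; apply: stalk_eq; rewrite /= gi_const rmorph1.
Qed.

End Point.

(** The preimage of the basic open set D(f) is D([Psi f]). *)
Lemma proj_map_open (W : set (projPt S')) : open W -> open (proj_map @^-1` W).
Proof.
move=> oW; suff : Defs.proj_open (proj_map @^-1` W) by [].
move=> p /(oW _) [d [f [Sf pf fW]]]; exists d, (Psi f); split=> //.
  exact: gi_part.
by move=> q qf; apply: fW.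
Qed.

Section Sections.
Variables (U : set (projPt S')) (V : set (projPt S)).
Hypothesis VU : forall p, V p -> U (proj_map p).

Fact sec_map_loc (s : osec U) :
  locally_frac (fun p (Vp : V p) => germ_map (s _ (VU Vp))).
Proof.
move=> p Vp; have [W [a [f [oW Wp sE]]]] := os_loc s (VU Vp).
exists (proj_map @^-1` W), (Psi a), (Psi f); split=> //.
  exact: proj_map_open.
move=> q Vq Wq; have [x [xa xf ->]] := sE _ (VU Vq) Wq.
by exists (hf_map x); rewrite /= xa xf germ_map_pi.
Qed.

(** [V] is not fixed to be the preimage of [U]: the inverse of [proj_sh] must land in sections over
    [U] itself, which agrees with the preimage of its preimage only through [proj_mapK]. *)
Definition sec_map (s : osec U) : osec V := OSec (sec_map_loc s).

Fact sec_map_nmod : nmod_morphism sec_map.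
Proof.
split=> [|s t]; apply: osec_eq => p Vp /=; last exact: germ_mapD.
exact: germ_map_const.
Qed.
Fact sec_map_monoid : monoid_morphism sec_map.
Proof.
split=> [|s t]; apply: osec_eq => p Vp /=; last exact: germ_mapM.
exact: germ_map_const.
Qed.
HB.instance Definition _ :=
  GRing.isNmodMorphism.Build (osec U) (osec V) sec_map sec_map_nmod.
HB.instance Definition _ :=
  GRing.isMonoidMorphism.Build (osec U) (osec V) sec_map sec_map_monoid.

End Sections.
End ProjMap.

Section Cancel.
Variables (K : comNzRingType) (S' S : gradedAlg K).
Variables (A : gradedIso S' S) (B : gradedIso S S').
Hypothesis AK : cancel (gi_fun A) (gi_fun B).

(** Proj is contravariant, so [A] and [B] change order. This lemma and the next use only one
    cancellation law; applying them twice with the roles exchanged gives bijectivity. *)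
Lemma proj_mapK : cancel (proj_map B) (proj_map A).
Proof. by move=> p; apply: projPt_eq => x /=; rewrite AK. Qed.

Lemma sec_mapK (U : set (projPt S')) (V : set (projPt S))
    (VU : forall p, V p -> U (proj_map A p))
    (UV : forall q, U q -> V (proj_map B q)) :
  cancel (sec_map VU) (sec_map UV).
Proof.
move=> s; apply: osec_eq => q Uq /=; move: (VU _ _) => Uq'.
(* The two germs live in stalks at points that are only propositionally equal. Numerators and
   denominators live in [S'] whatever the point, so they can be compared after rewriting the
   point. *)
have [x [y [xy xy' -> ->]]] : exists (x : hfrac (proj_map A (proj_map B q)))
    (y : hfrac q), [/\ hf_num x = hf_num y, hf_den x = hf_den y,
    s _ Uq' = \pi x & s q Uq = \pi y].
  move: Uq'; rewrite proj_mapK => Uq'.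
  exists (repr (s q Uq)), (repr (s q Uq)).
  by split; rewrite ?reprK// (Prop_irrelevance Uq' Uq).
by rewrite !germ_map_pi; apply: stalk_eq; rewrite /= xy xy' !AK.
Qed.

End Cancel.

Section ProjIso.
Variables (K : comNzRingType) (S' S : gradedAlg K) (A : gradedIso S' S).
Let A' := gradedIso_sym A.

Let projK : cancel (proj_map A) (proj_map A').
Proof. exact: (proj_mapK (A := A') (B := A) (gi_invK A)). Qed.

Let projVK : cancel (proj_map A') (proj_map A).
Proof. exact: (proj_mapK (B := A') (gi_funK A)). Qed.

Fact proj_map_bij : bijective (proj_map A).
Proof. by exists (proj_map A'); [exact: projK|exact: projVK]. Qed.

Fact proj_map_continuous : continuous (proj_map A).
Proof. by apply/continuousP => W; apply: proj_map_open. Qed.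

Fact proj_map_image_open (U : set (projPt S)) :
  open U -> open (proj_map A @` U).
Proof.
have -> : proj_map A @` U = proj_map A' @^-1` U; last exact: proj_map_open.
apply/seteqP; split=> [_ [p Up <-]|q Uq] /=; first by rewrite projK.
by exists (proj_map A' q) => //; apply: projVK.
Qed.

Definition proj_sh (U : set (projPt S')) (oU : open U) :
    {rmorphism osec U -> osec (proj_map A @^-1` U)} :=
  sec_map (A := A) (fun p (Up : (proj_map A @^-1` U) p) => Up).

Fact proj_sh_bij (U : set (projPt S')) (oU : open U) : bijective (proj_sh oU).
Proof.
have UV q : U q -> (proj_map A @^-1` U) (proj_map A' q).
  by move=> Uq; rewrite /= projVK.
exists (sec_map UV); first exact: (sec_mapK (B := A') (gi_funK A)).
exact: (sec_mapK (A := A') (B := A) (gi_invK A)).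
Qed.

Fact proj_sh_const (U : set (projPt S')) (oU : open U) c :
  proj_sh oU (os_const U c) = os_const _ c.
Proof. by apply: osec_eq => p Up; apply: germ_map_const. Qed.

Fact proj_sh_restr (U V : set (projPt S')) (oU : open U) (oV : open V)
    (VU : V `<=` U) s :
  proj_sh oV (os_restr VU s) = os_restr (preimage_subset VU) (proj_sh oU s).
Proof.
apply: osec_eq => p Vp /=; congr (germ_map (s _ _)); exact: Prop_irrelevance.
Qed.

Definition proj_iso : projIso S S' :=
  ProjIso proj_map_bij proj_map_continuous proj_map_image_open proj_sh_bij
    proj_sh_const proj_sh_restr.

Lemma proj_iso_induced : induced_by (gi_fun A) proj_iso.
Proof.
split=> [//|U oU s p Up x sx]; exists (hf_map x); split=> //.
by rewrite /= sx germ_map_pi.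
Qed.

End ProjIso.

(** * Lifting [theta] to the base spaces and the line bundles *)

(** These properties of [theta] let it act on the bundles. The record is to be used for (L, L') and
    for (L', L), which makes the two lifts mutually inverse. *)
Record intertwines (R : realType) (n : nat)
    (theta : 'M[cplx R]_n.+1 -> 'M[cplx R]_n.+1) (L L' : linBundle R n) : Prop :=
  Intertwines {
  iw_grp : forall g, lb_grp L g -> lb_grp L' (theta g);
  iw_mul : forall x y, lb_grp L x -> lb_grp L y ->
    theta (x * y) = theta x * theta y;
  iw_invol : forall x, lb_grp L x -> theta (theta x) = x;
  iw_holo : holomorphic_on (fun x : lb_grp L => theta (val x));
  iw_par : forall p, lb_par L p -> lb_par L' (theta p);
  iw_par_inv : forall p, lb_par L' p -> lb_par L (theta p);
  iw_par_invol : forall x, lb_par L' x -> theta (theta x) = x;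
  iw_chi : forall p, lb_par L p -> lb_chi L' (theta p) = lb_chi L p;
  iw_tor : forall h, lb_tor L h -> lb_tor L' (theta h);
  iw_tw : forall h, lb_tor L h -> lb_tw L' (theta h) = lb_tw L h
}.

Section Intertwiner.
Variables (R : realType) (n : nat) (L L' : linBundle R n).
Notation C := (cplx R).
Notation V := 'M[C]_n.+1.
Variable theta : V -> V.
Hypothesis iw : intertwines theta L L'.

(** The image of a class is a full class because [theta] maps [lb_par L] onto [lb_par L'], the
    element [theta p] being the preimage of [p], and matches the characters. *)
Lemma hatTheta_cls N g z : lb_grp L g ->
  hatTheta theta (cls L N g z) = cls L' N (theta g) z.
Proof.
move=> Gg; have PG := lb_par_sub (l := L).
apply/seteqP; split=> [_ [_ [p Pp <-] <-]|_ [p Pp <-]] /=.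
  exists (theta p); first exact: (iw_par iw).
  by rewrite (iw_chi iw Pp) (iw_mul iw Gg (PG _ Pp)).
have Pp' := iw_par_inv iw Pp.
exists (g * theta p, lb_chi L (theta p) ^+ N * z); first by exists (theta p).
by rewrite /= (iw_mul iw Gg (PG _ Pp')) -(iw_chi iw Pp') (iw_par_invol iw Pp).
Qed.

Lemma Theta_coset g : lb_grp L g ->
  Theta theta (coset_pt L g) = coset_pt L' (theta g).
Proof.
move=> Gg; have PG := lb_par_sub (l := L).
apply/seteqP; split=> [_ [_ [p Pp <-] <-]|_ [p Pp <-]] /=.
  by exists (theta p); [exact: (iw_par iw)|rewrite (iw_mul iw Gg (PG _ Pp))].
have Pp' := iw_par_inv iw Pp; exists (g * theta p); first by exists (theta p).
by rewrite (iw_mul iw Gg (PG _ Pp')) (iw_par_invol iw Pp).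
Qed.

(** Equivariance holds along [theta] on the torus: the twist of [L'] at [theta h] is that of [L] at
    [h]. *)
Lemma hatTheta_act h c : lb_tor L h -> total_space L 1 c ->
  hatTheta theta (act_total L 1 h c)
  = act_total L' 1 (theta h) (hatTheta theta c).
Proof.
move=> Hh [g Gg [z ->]]; have PG := lb_par_sub (l := L).
have [_ _ GM _] := lb_grpP L; have Gh := lb_tor_sub Hh.
have E p : lb_par L p -> theta (h * (g * p)) = theta h * theta (g * p).
  by move=> Pp; rewrite (iw_mul iw)//; apply: GM => //; apply: PG.
apply/seteqP; split=> [_ [_ [_ [p Pp <-] <-] <-]|_ [_ [_ [p Pp <-] <-] <-]] /=.
  rewrite E// -(iw_tw iw Hh).
  exists (theta (g * p), lb_chi L p ^+ 1 * z) => //.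
  by exists (g * p, lb_chi L p ^+ 1 * z) => //; exists p.
rewrite -E// (iw_tw iw Hh).
exists (h * (g * p), lb_tw L h ^+ 1 * (lb_chi L p ^+ 1 * z)) => //.
by exists (g * p, lb_chi L p ^+ 1 * z) => //; exists p.
Qed.

Lemma hatThetaK c : total_space L 1 c -> hatTheta theta (hatTheta theta c) = c.
Proof.
move=> [g Gg [z ->]]; have PG := lb_par_sub (l := L).
have [_ _ GM _] := lb_grpP L.
apply/seteqP; split=> [_ [_ [_ [p Pp <-] <-] <-]|_ [p Pp <-]] /=.
  by rewrite (iw_invol iw); [exists p|apply: GM => //; apply: PG].
exists (theta (g * p), lb_chi L p ^+ 1 * z).
  by exists (g * p, lb_chi L p ^+ 1 * z) => //; exists p.
by rewrite /= (iw_invol iw)//; apply: GM => //; apply: PG.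
Qed.

Lemma ThetaK x : base_space L x -> Theta theta (Theta theta x) = x.
Proof.
move=> [g Gg <-]; have PG := lb_par_sub (l := L).
have [_ _ GM _] := lb_grpP L.
apply/seteqP; split=> [_ [_ [_ [p Pp <-] <-] <-]|_ [p Pp <-]] /=.
  by rewrite (iw_invol iw); [exists p|apply: GM => //; apply: PG].
exists (theta (g * p)); first by exists (g * p) => //; exists p.
by rewrite (iw_invol iw)//; apply: GM => //; apply: PG.
Qed.

End Intertwiner.

(** * Holomorphy of maps between quotients *)

Section QuotientMaps.
Variables (R : realType) (E E' : normedModType (cplx R)) (A : set E) (A' : set E').
Variables (X X' : Type) (q : E -> X) (q' : E' -> X') (f : E -> E') (T : X -> X').

(** Openness and holomorphy on a quotient are tested upstairs, where the lift [f] reduces them to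
    continuity and the chain rule. *)
Lemma quot_holo_map_lift :
  (forall e, A e -> A' (f e)) -> holomorphic_on (fun x : A => f (val x)) ->
  (forall e, A e -> T (q e) = q' (f e)) -> quot_holo_map A A' q q' T.
Proof.
move=> fA hf Tq W phi [U oU WU] hphi; split.
(* Since [f] extends to a differentiable map only locally, the open set is glued from all open [D]
   that meet [A] inside the preimage of [W]; the sets [D] ∩ [F]^-1([U]) show that they cover it. *)
- exists (\bigcup_(D in [set D : set E | open D /\
      forall e, D e -> A e -> W (T (q e))]) D).
    by apply: bigcup_open => D [].
  move=> e Ae; split=> [We|[D [_ DW] De]]; last exact: DW.
  have [D [F [oD De dF FE]]] := hf (exist (fun x => x \in A) e (mem_set Ae)).
  exists (D `&` F @^-1` U) => /=.
    split.
      rewrite openE => y [Dy Uy]; apply: filterI; first exact: open_nbhs_nbhs.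
      apply: (differentiable_continuous (dF _ Dy)); exact: open_nbhs_nbhs.
    move=> y [Dy UFy] Ay; rewrite Tq//; apply/WU; first exact: fA.
    by have <- := FE (exist (fun x => x \in A) y (mem_set Ay)) Dy.
  split=> //; rewrite /= (FE (exist (fun x => x \in A) e (mem_set Ae)) De) /=.
  by apply/WU; [exact: fA|rewrite -Tq].
- move=> e Ae We; have We' : W (q' (f e)) by rewrite -Tq.
  have [U1 [F1 [oU1 U1e dF1 F1E]]] := hphi _ (fA _ Ae) We'.
  have [D [F [oD De dF FE]]] := hf (exist (fun x => x \in A) e (mem_set Ae)).
  have FA y (Dy : D y) (Ay : A y) : F y = f y.
    exact: FE (exist (fun x => x \in A) y (mem_set Ay)) Dy.
  exists (D `&` F @^-1` U1), (F1 \o F); split.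
  + rewrite openE => y [Dy Uy]; apply: filterI; first exact: open_nbhs_nbhs.
    apply: (differentiable_continuous (dF _ Dy)); exact: open_nbhs_nbhs.
  + by split=> //=; rewrite FA.
  + by move=> y [Dy Uy]; apply: differentiable_comp; [exact: dF|exact: dF1].
  + move=> y [Dy] /= + Ay; rewrite FA// => Uy.
    by have [Wy ->] := F1E _ Uy (fA _ Ay); rewrite /= Tq.
Qed.

End QuotientMaps.

(** Used for the lift (g, z) |-> (theta(g), z) of [hatTheta] to G x C. *)
Lemma holomorphic_on_prodr (R : realType) (E E' F : normedModType (cplx R))
    (A : set E) (f : E -> E') : holomorphic_on (fun x : A => f (val x)) ->
  holomorphic_on (fun x : (A `*` [set: F]) => (f (val x).1, (val x).2)).
Proof.
move=> hf x; have Ax : (val x).1 \in A by have := valP x; rewrite inE => -[/mem_set].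
have [D [G [oD Dx dG GE]]] := hf (exist (fun x => x \in A) _ Ax).
exists (fst @^-1` D), (fun e => (G e.1, e.2)); split=> //.
- by apply: open_comp => // y _; apply: cvg_fst.
- move=> y Dy; apply: differentiable_pair.
    apply: (@differentiable_comp _ _ _ _ fst G); last exact: dG.
    by apply: linear_differentiable => z; apply: cvg_fst.
  by apply: linear_differentiable => z; apply: cvg_snd.
- move=> y Dy; have Ay : (val y).1 \in A by have := valP y; rewrite inE => -[/mem_set].
  by rewrite (GE (exist (fun x => x \in A) _ Ay)).
Qed.

(** * Pullback of invariant sections along [theta] *)

Section Pullback.
Variables (R : realType) (n : nat) (L L' : linBundle R n).
Notation C := (cplx R).
Notation V := 'M[C]_n.+1.
Variable theta : V -> V.
Hypothesis iw : intertwines theta L L'.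

Lemma intertwines_bundle_map :
  bundle_map L L' (hatTheta theta) (Theta theta).
Proof.
have base_cls (L0 : linBundle R n) g z : proj_base (cls L0 1 g z) = coset_pt L0 g.
  apply/seteqP; split=> [_ [_ [p Pp <-] <-]|_ [p Pp <-]]; first by exists p.
  by exists (g * p, lb_chi L0 p ^+ 1 * z) => //; exists p.
split.
- move=> _ [g Gg [z ->]]; rewrite (hatTheta_cls iw)//.
  by exists (theta g); [exact: (iw_grp iw)|exists z].
- move=> _ [g Gg <-]; rewrite (Theta_coset iw)//.
  by exists (theta g) => //; exact: (iw_grp iw).
- move=> _ [g Gg [z ->]].
  by rewrite (hatTheta_cls iw)// !base_cls (Theta_coset iw).
- move=> g Gg; exists (theta g); first exact: (iw_grp iw).
  by exists 1 => z; rewrite mul1r (hatTheta_cls iw).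
- apply: (quot_holo_map_lift (f := fun e => (theta e.1, e.2))).
  + by move=> e [Ge _]; split=> //; apply: (iw_grp iw).
  + exact: (holomorphic_on_prodr (iw_holo iw)).
  + by move=> e [Ge _]; rewrite /total_pt (hatTheta_cls iw).
- apply: (quot_holo_map_lift (iw_grp iw) (iw_holo iw)).
  exact: (Theta_coset iw).
Qed.

Definition theta_pt (g : lb_pts L) : lb_pts L' :=
  exist (fun x => x \in lb_grp L') (theta (val g))
    (mem_set (iw_grp iw (set_mem (valP g)))).

(** [hatTheta] leaves the fibre coordinate unchanged, so pulling back the section with coordinate
    [f] amounts to composing [f] with [theta]. Pointwise operations commute with this by
    computation. *)
Definition theta_comp (f : lb_pts L' -> C) : lb_pts L -> C := f \o theta_pt.

Fact theta_comp_zmod : zmod_morphism theta_comp.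
Proof. by []. Qed.
Fact theta_comp_monoid : monoid_morphism theta_comp.
Proof. by []. Qed.
HB.instance Definition _ := GRing.isZmodMorphism.Build
  (lb_pts L' -> C) (lb_pts L -> C) theta_comp theta_comp_zmod.
HB.instance Definition _ := GRing.isMonoidMorphism.Build
  (lb_pts L' -> C) (lb_pts L -> C) theta_comp theta_comp_monoid.

(** By [inv_coordP], being an invariant section is holomorphy plus equivariance under the parabolic
    and the torus. These follow from the chain rule, [iw_chi] and [iw_tw] respectively. *)
Lemma inv_coord_theta N (f : lb_pts L' -> C) :
  inv_coord N f -> inv_coord N (theta_comp f).
Proof.
have inG (g : lb_pts L) : lb_grp L (val g) by apply: set_mem (valP g).
move=> /inv_coordP[hf fP fH]; apply/inv_coordP; split.
- move=> g; have [U [F [oU Ug dF FE]]] := iw_holo iw g.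
  have [U' [F' [oU' U'g dF' FE']]] := hf (theta_pt g).
  exists (U `&` F @^-1` U'), (F' \o F); split.
  + rewrite openE => y [Uy Uy']; apply: filterI; first exact: open_nbhs_nbhs.
    apply: (differentiable_continuous (dF _ Uy)); exact: open_nbhs_nbhs.
  + by split=> //=; rewrite FE.
  + by move=> y [Uy Uy']; apply: differentiable_comp; [exact: dF|exact: dF'].
  + by move=> y [Uy] /=; rewrite FE// => Uy'; apply: (FE' (theta_pt y)).
- move=> g g' p Pp g'E; rewrite -(iw_chi iw Pp); apply: fP; first exact: (iw_par iw).
  by rewrite /= g'E (iw_mul iw)//; apply: lb_par_sub.
- move=> g g' h Hh g'E; rewrite -(iw_tw iw Hh); apply: fH; first exact: (iw_tor iw).
  by rewrite /= g'E (iw_mul iw)//; apply: lb_tor_sub.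
Qed.

Fact inv_pullback_subproof (a : inv_ring L') :
  map_poly theta_comp (inv_val a) \in @inv_poly R n L.
Proof.
apply/asboolP => N; rewrite coef_map; apply: inv_coord_theta.
by have /asboolP := valP a; apply.
Qed.
Definition inv_pullback (a : inv_ring L') : inv_ring L :=
  InvRing (inv_pullback_subproof a).

Fact inv_pullback_zmod : zmod_morphism inv_pullback.
Proof. by move=> a b; apply: val_inj; apply: rmorphB. Qed.
Fact inv_pullback_monoid : monoid_morphism inv_pullback.
Proof.
by split=> [|a b]; apply: val_inj; [exact: rmorph1|exact: rmorphM].
Qed.
HB.instance Definition _ := GRing.isZmodMorphism.Build
  (inv_ring L') (inv_ring L) inv_pullback inv_pullback_zmod.
HB.instance Definition _ := GRing.isMonoidMorphism.Build
  (inv_ring L') (inv_ring L) inv_pullback inv_pullback_monoid.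

Lemma inv_pullback_coef a i :
  (inv_val (inv_pullback a))`_i = theta_comp (inv_val a)`_i.
Proof. exact: coef_map. Qed.

Lemma inv_pullback_part N a : inv_part N a -> inv_part N (inv_pullback a).
Proof. by move=> Ia i iN; rewrite inv_pullback_coef Ia. Qed.

Lemma inv_pullback_const c : inv_pullback (inv_const L' c) = inv_const L c.
Proof. by apply: val_inj; rewrite /= map_polyC. Qed.

(** At the coset of g both sides are the class of theta(g) with fibre coordinate the N-th
    coefficient of [a] at theta(g). *)
Lemma inv_pullback_section :
  section_pullback (hatTheta theta) (Theta theta) inv_pullback.
Proof.
move=> N a s' s ss' ss _ [g Gg <-].
pose g0 : lb_pts L := exist (fun x => x \in lb_grp L) g (mem_set Gg).
have := ss g0; rewrite [val g0]/= => ->.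
rewrite (hatTheta_cls iw)// (Theta_coset iw)//.
by have := ss' (theta_pt g0); rewrite [val _]/= => ->; rewrite inv_pullback_coef.
Qed.

End Pullback.

(** Going forth and back composes each coefficient with [theta] twice, which is the identity on the
    group. *)
Lemma inv_pullbackK (R : realType) (n : nat) (L L' : linBundle R n) theta
    (iw : intertwines theta L L') (iw' : intertwines theta L' L) :
  cancel (inv_pullback iw) (inv_pullback iw').
Proof.
move=> a; apply: val_inj; apply/polyP => i; rewrite !inv_pullback_coef.
apply/funext => g /=; congr ((inv_val a)`_i _); apply: val_inj => /=.
exact: (iw_invol iw' (set_mem (valP g))).
Qed.

(** * The induced isomorphisms of bundles and of GIT quotients *)

Section InducedIso.
Variables (R : realType) (n : nat) (L L' : linBundle R n).
Variable theta : 'M[cplx R]_n.+1 -> 'M[cplx R]_n.+1.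
Hypotheses (iw : intertwines theta L L') (iw' : intertwines theta L' L).

Lemma intertwines_bundle_iso :
  bundle_iso L L' (hatTheta theta) (Theta theta).
Proof.
split; first exact: intertwines_bundle_map.
exists (hatTheta theta), (Theta theta); split.
- exact: intertwines_bundle_map.
- exact: (hatThetaK iw).
- exact: (hatThetaK iw').
- exact: (ThetaK iw).
- exact: (ThetaK iw').
Qed.

Definition inv_gradedIso : gradedIso (inv_alg L') (inv_alg L) :=
  @GradedIso _ (inv_alg L') (inv_alg L) (inv_pullback iw) (inv_pullback iw')
    (inv_pullbackK iw iw') (inv_pullbackK iw' iw)
    (@inv_pullback_part _ _ _ _ _ iw) (@inv_pullback_part _ _ _ _ _ iw')
    (inv_pullback_const iw) (inv_pullback_const iw').

(** Sections pull back from [L'] to [L], so Proj of the pullback goes from the quotient for [L] to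
    the one for [L'], in the direction of [Theta]. *)
Lemma intertwines_quotient_iso :
  induces_quotient_iso L L' (hatTheta theta) (Theta theta).
Proof.
exists (inv_pullback iw), (proj_iso inv_gradedIso); split.
- by exists (inv_pullback iw'); apply: inv_pullbackK.
- move=> N; apply/seteqP; split=> [_ [a Ia <-]|a Ia].
    exact: inv_pullback_part.
  exists (inv_pullback iw' a); first exact: inv_pullback_part.
  exact: inv_pullbackK.
- exact: inv_pullback_const.
- exact: inv_pullback_section.
- exact: (proj_iso_induced inv_gradedIso).
Qed.

End InducedIso.

(** * The Chevalley involution and the two opposite bundles *)

(** The characters of the parabolics match because [theta] is an involution. The twists match
    because [theta] inverts H while the second twist is the inverse character: the two signs
    cancel. *)
Lemma opp_bundle_intertwines (R : realType) (n : nat)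
    (G H P : set 'M[cplx R]_n.+1) (theta : 'M[cplx R]_n.+1 -> 'M[cplx R]_n.+1)
    (chi tw : 'M[cplx R]_n.+1 -> cplx R)
    (hG : semisimple_group G) (hH : maximal_torus G H)
    (hP : parabolic_subgroup G P) (hchi : is_character P chi)
    (htw : is_character H tw) (htheta : chevalley_involution G theta) :
  (forall h, H h -> theta h = h^-1) ->
  let L := hom_bundle hG hH hP hchi htw in
  let L' := opp_bundle hG hH hP hchi htw htheta in
  intertwines theta L L' /\ intertwines theta L' L.
Proof.
move=> hthetaH L L'; have [[thG thM thK thh] _] := htheta.
have PG := parabolic_sub hP; have P'G := opp_sub hP htheta.
have HV h : H h -> H h^-1 by have [_ _ _] := torus_subgroup hH; apply.
have Hu h : H h -> h \is a GRing.unit.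
  by have [+ _ _ _] := torus_subgroup hH; apply.
have twV h : H h -> (tw h^-1)^-1 = tw h.
  move=> Hh; have [tw0 twM _] := htw; have H1 : H 1.
    by have [_ H1 _ _] := torus_subgroup hH.
  have tw1 : tw 1 = 1 by apply: (mulfI (tw0 _ H1)); rewrite -twM// !mulr1.
  apply: (mulIf (tw0 _ (HV _ Hh))); rewrite mulVf; last exact/tw0/HV.
  by rewrite -twM ?divrr ?tw1//; [exact: Hu|exact: HV].
have thP' p : (theta @` P) p -> P (theta p).
  by move=> [q Pq <-]; rewrite thK//; apply: PG.
split; split=> //=.
- by move=> p Pp; exists p.
- by move=> x /P'G; apply: thK.
- by move=> p /PG Gp; rewrite thK.
- by move=> h Hh; rewrite hthetaH//; apply: HV.
- by move=> h Hh; rewrite hthetaH// twV.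
- by move=> p Pp; exists p.
- by move=> x /PG; apply: thK.
- by move=> h Hh; rewrite hthetaH//; apply: HV.
(* With the bundles exchanged, the identity [twV] is needed in inverted form. *)
- by move=> h Hh; rewrite hthetaH// -[in RHS](twV _ Hh) invrK.
Qed.

Theorem theorem1p18 (R : realType) (n : nat)
    (G H B P : set 'M[cplx R]_n.+1)
    (theta : 'M[cplx R]_n.+1 -> 'M[cplx R]_n.+1)
    (lam r : 'M[cplx R]_n.+1 -> cplx R)
    (chi_lam chi chi_r : 'M[cplx R]_n.+1 -> cplx R)
    (hG : semisimple_group G) (hGsc : simply_connected G)
    (hH : maximal_torus G H)
    (htheta : chevalley_involution G theta)
    (hthetaH : forall h, H h -> theta h = h^-1)
    (hB : borel_subgroup G B) (hHB : H `<=` B)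
    (hBH : B `&` (theta @` B) = H)
    (hP : parabolic_subgroup G P) (hBP : B `<=` P)
    (hlam : dominant_weight G H B lam)
    (hchi_lam : weight_character H lam chi_lam)
    (hchi : extends_to H P chi_lam chi)
    (hmax : forall Q, parabolic_subgroup G Q -> P `<=` Q ->
       (exists chi', extends_to H Q chi_lam chi') -> Q = P)
    (hr : is_weight G H r) (hchi_r : weight_character H r chi_r) :
  let L := hom_bundle hG hH hP (proj1 hchi) (proj1 hchi_r) in
  let L' := opp_bundle hG hH hP (proj1 hchi) (proj1 hchi_r) htheta in
  [/\ forall N g z, G g ->
        hatTheta theta (cls L N g z) = cls L' N (theta g) z,
      bundle_iso L L' (hatTheta theta) (Theta theta),
      forall h c, H h -> total_space L 1 c ->
        hatTheta theta (act_total L 1 h c)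
        = act_total L' 1 h^-1 (hatTheta theta c)
    & induces_quotient_iso L L' (hatTheta theta) (Theta theta)].
Proof.
move=> L L'.
have [iw iw'] := opp_bundle_intertwines hG hH hP (proj1 hchi) (proj1 hchi_r)
  htheta hthetaH.
split.
- exact: (hatTheta_cls iw).
- exact: (intertwines_bundle_iso iw iw').
- by move=> h c Hh Lc; rewrite (hatTheta_act iw)// hthetaH.
- exact: (intertwines_quotient_iso iw iw').
Qed.
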